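(* Let $\lambda$ be a nonzero real number. For integers $n\ge 0$ let $(x)_{0,\mu}=1$ and $(x)_{n,\mu}=x(x-\mu)\cdots(x-(n-1)\mu)$ for $n\ge1$, for any nonzero parameter $\mu$, and let $e_{\lambda}^{x}(t)=\sum_{k\ge0}(x)_{k,\lambda}t^k/k!$, $e_\lambda(t)=e_\lambda^1(t)$. Define the degenerate Bernoulli polynomials by $\frac{t}{e_{\lambda}(t)-1}e_{\lambda}^{x}(t)=\sum_{n=0}^{\infty}\beta_{n,\lambda}(x)\frac{t^{n}}{n!}$ and $\beta_{n,\lambda}=\beta_{n,\lambda}(0)$. Define the degenerate Eulerian polynomials with parameter $\mu$ by $\sum_{j=0}^{\infty}(j+1)_{n,\mu}x^{j}=\frac{A_{n,\mu}(x)}{(1-x)^{n+1}}$ for $|x|<1$, and the degenerate Eulerian numbers by $A_{n,\mu}(x)=\sum_{k=0}^{n}A_{\mu}(n,k)x^{k}$. Then for all positive integers $m,n$, \[\sum_{j=0}^{n}A_{-\lambda}(n,j)\binom{m+j+1}{n+1}=\frac{1}{n+1}\Big(\beta_{n+1,\lambda}(m+1)-\beta_{n+1,\lambda}\Big).\]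
   Context: $A_{-\lambda}(n,j)$ is the degenerate Eulerian number with parameter $\mu=-\lambda$. *)

(* Defs.v *)
From HB Require Import structures.
From mathcomp Require Import all_boot all_order all_algebra.
From mathcomp Require Import all_classical all_reals all_analysis.

Set Implicit Arguments.
Unset Strict Implicit.
Unset Printing Implicit Defensive.

Import Order.TTheory GRing.Theory Num.Theory.
Import numFieldNormedType.Exports.

Local Open Scope classical_set_scope.
Local Open Scope ring_scope.

(* (x)_{n,mu} = x (x - mu) ... (x - (n-1) mu) *)
Definition deg_falling {R : realType} (mu x : R) (n : nat) : R :=
  \prod_(i < n) (x - i%:R * mu).

(* A formal power series sum_n f_n t^n is represented by its coefficient
   sequence f : nat -> R.  Addition of series is pointwise, but the unit and
   the product are not those of the pointwise ring structure on nat -> R. *)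
Definition fps_one {R : realType} : nat -> R := fun n => (n == 0%N)%:R.

Definition fps_t {R : realType} : nat -> R := fun n => (n == 1%N)%:R.

Definition fps_mul {R : realType} (f g : nat -> R) : nat -> R :=
  fun n => \sum_(i < n.+1) f i * g (n - i)%N.

(* The quotient of f by g when g divides f in the integral domain R[[t]] and
   g is nonzero.  Here g may have a zero constant term, as in t / (e(t) - 1). *)
Definition fps_div {R : realType} (f g : nat -> R) : nat -> R :=
  get [set h : nat -> R | fps_mul h g = f].

(* e_lambda^x (t) = sum_k (x)_{k,lambda} t^k / k! *)
Definition deg_exp {R : realType} (lambda x : R) : nat -> R :=
  fun k => deg_falling lambda x k / k`!%:R.

(* t / (e_lambda(t) - 1) * e_lambda^x(t) = sum_n beta_{n,lambda}(x) t^n / n! *)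
Definition deg_Bernoulli {R : realType} (lambda : R) (n : nat) (x : R) : R :=
  n`!%:R *
  fps_mul (fps_div fps_t (deg_exp lambda 1 \- fps_one)) (deg_exp lambda x) n.

(* A_{n,mu} is the polynomial of degree at most n such that
   sum_(j >= 0) (j+1)_{n,mu} x^j = A_{n,mu}(x) / (1 - x)^(n+1) for |x| < 1. *)
Definition deg_Eulerian_poly {R : realType} (mu : R) (n : nat) : {poly R} :=
  xget 0 [set A : {poly R} | (size A <= n.+1)%N /\
    forall x : R, `|x| < 1 ->
      series (fun j : nat => deg_falling mu (j.+1)%:R n * x ^+ j) @ \oo
        --> A.[x] / (1 - x) ^+ n.+1].

Definition deg_Eulerian {R : realType} (mu : R) (n k : nat) : R :=
  (deg_Eulerian_poly mu n)`_k.

(* Main.v *)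
(* Both sides equal the sum of (x)_{n,lambda} over x = 0, ..., m.
   On the right, the generating function in t of the beta_{n,lambda}(x) gives
   beta_{n+1,lambda}(x+1) - beta_{n+1,lambda}(x) = (n+1) (x)_{n,lambda}, and
   the sum telescopes.  On the left, one uses the Worpitzky identity
   (x)_{n,lambda} = sum_k A_{-lambda}(n,k) C(x+k,n) and the hockey-stick
   identity.  Coefficients a_k satisfying the Worpitzky identity exist by
   induction on n; they are the Eulerian numbers, because the reflection
   x |-> -x turns it into an expansion of (j+1)_{n,-lambda} in the C(j-k+n,n),
   which are the coefficients of x^k / (1-x)^(n+1). *)
Require Import Defs.
From HB Require Import structures.
From mathcomp Require Import all_boot all_order all_algebra.
From mathcomp Require Import ring zify.
From mathcomp Require Import all_classical all_reals all_analysis.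

Set Implicit Arguments.
Unset Strict Implicit.
Unset Printing Implicit Defensive.

Import Order.TTheory GRing.Theory Num.Theory.
Import numFieldNormedType.Exports.

Local Open Scope classical_set_scope.
Local Open Scope ring_scope.

(** * Degenerate falling factorials and binomial coefficients of a real argument *)

Lemma deg_falling0 (R : realType) (mu x : R) : deg_falling mu x 0 = 1.
Proof. exact: big_ord0. Qed.

Lemma deg_fallingS (R : realType) (mu x : R) n :
  deg_falling mu x n.+1 = deg_falling mu x n * (x - n%:R * mu).
Proof. exact: big_ord_recr. Qed.

Lemma deg_falling_opp (R : realType) (mu x : R) n :
  deg_falling (- mu) x n = (-1) ^+ n * deg_falling mu (- x) n.
Proof.
elim: n => [|n IHn]; first by rewrite !deg_falling0 mulr1.
by rewrite !deg_fallingS IHn exprS; ring.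
Qed.

Lemma deg_falling1_addS (R : realType) (x : R) n :
  deg_falling 1 (x + 1) n.+1 = (x + 1) * deg_falling 1 x n.
Proof.
rewrite /deg_falling big_ord_recl mul0r subr0; congr (_ * _).
by apply: eq_bigr => i _; rewrite lift0 -natr1; ring.
Qed.

Lemma deg_falling1_nat (R : realType) N n :
  deg_falling 1 (N%:R : R) n = (N ^_ n)%:R.
Proof.
elim: n => [|n IHn]; first by rewrite deg_falling0 ffactn0.
rewrite deg_fallingS IHn ffactnSr natrM mulr1.
have [lenN|ltNn] := leqP n N; first by rewrite natrB.
by rewrite ffact_small // !mul0r.
Qed.

Lemma fact_neq0 (R : realType) n : n`!%:R != 0 :> R.
Proof. by rewrite pnatr_eq0 -lt0n fact_gt0. Qed.

Lemma deg_exp0 (R : realType) (lambda x : R) : deg_exp lambda x 0 = 1.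
Proof. by rewrite /deg_exp deg_falling0 divr1. Qed.

Lemma deg_expS (R : realType) (lambda x : R) n :
  n.+1%:R * deg_exp lambda x n.+1 = (x - n%:R * lambda) * deg_exp lambda x n.
Proof.
rewrite /deg_exp deg_fallingS factS natrM invfM mulrCA !mulrA.
by rewrite mulfK ?pnatr_eq0 // [_ * deg_falling _ _ _]mulrC.
Qed.

(* deg_exp 1 x n is the binomial coefficient C(x, n) for real x. *)
Lemma deg_exp1_addS (R : realType) (x : R) n :
  n.+1%:R * deg_exp 1 (x + 1) n.+1 = (x + 1) * deg_exp 1 x n.
Proof.
rewrite /deg_exp deg_falling1_addS factS natrM invfM mulrCA !mulrA.
by rewrite mulfK ?pnatr_eq0.
Qed.

Lemma deg_exp1_nat (R : realType) N n :
  deg_exp 1 (N%:R : R) n = 'C(N, n)%:R.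
Proof.
by rewrite /deg_exp deg_falling1_nat -bin_ffact natrM mulfK ?fact_neq0.
Qed.

(** Upper negation C(-M-1, n) = (-1)^n C(M+n, n) with M = j - k. When j < k, the argument k - j - 1
    is a natural number below n, so the coefficient vanishes. *)
Lemma deg_exp1_nat_opp (R : realType) (k j n : nat) : (k <= n)%N ->
  (-1) ^+ n * deg_exp 1 (k%:R - j.+1%:R : R) n =
  if (k <= j)%N then 'C(j - k + n, n)%:R else 0.
Proof.
move=> lekn; case: leqP => [lekj|ltjk]; last first.
  by rewrite -natrB // deg_exp1_nat bin_small ?mulr0 //; lia.
have -> : k%:R - j.+1%:R = - (j - k).+1%:R :> R.
  by rewrite -[(j - k).+1%:R]natr1 natrB // -natr1; ring.
move: (j - k)%N => M; elim: n {lekn} => [|n IHn].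
  by rewrite deg_exp0 bin0 mulr1.
have n1 : n.+1%:R != 0 :> R by rewrite pnatr_eq0.
apply: (mulfI n1); rewrite mulrCA deg_expS addnS -natrM -mul_bin_diag.
by rewrite natrM -IHn exprS -!natr1 natrD; ring.
Qed.

Lemma worpitzky (R : realType) (mu : R) n : exists a : nat -> R,
  forall y, deg_falling (- mu) y n =
    \sum_(k < n.+1) a k * deg_exp 1 (y + k%:R) n.
Proof.
elim: n => [|n [a IHn]].
  by exists (fun=> 1) => y; rewrite big_ord1 deg_falling0 deg_exp0 mulr1.
(* The weights come from (n+1)(y + n mu) = (k+1 - n mu)(y+k-n) + (n-k + n mu)(y+k+1). The factor
   y+k-n turns C(y+k, n) into (n+1) C(y+k, n+1) and y+k+1 turns it into (n+1) C(y+k+1, n+1), so [al]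
   stays at index k and [be] moves to k+1. *)
pose al k := a k * (k%:R + 1 - n%:R * mu).
pose be k := a k * (n%:R - k%:R + n%:R * mu).
exists (fun k => (if (k <= n)%N then al k else 0) +
                 (if k is k'.+1 then be k' else 0)) => y.
under eq_bigr do rewrite mulrDl.
rewrite big_split /= big_ord_recr /= ltnn mul0r addr0.
rewrite [X in _ + X]big_ord_recl /= mul0r add0r -big_split /=.
rewrite deg_fallingS IHn mulr_suml; apply: eq_bigr => k _.
rewrite -ltnS ltn_ord /bump /=.
have n1 : n.+1%:R != 0 :> R by rewrite pnatr_eq0.
apply: (mulfI n1).
have E1 := deg_expS 1 (y + k%:R) n.
have E2 := deg_exp1_addS (y + k%:R) n.
rewrite natrD [1%:R + _]addrC addrA.
transitivity (al k * (n.+1%:R * deg_exp 1 (y + k%:R) n.+1) +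
  be k * (n.+1%:R * deg_exp 1 (y + k%:R + 1) n.+1)); last by ring.
by rewrite E1 E2 /al /be -natr1; ring.
Qed.

(** * The binomial series of (1 - x)^-(n+1) *)

Lemma binomial_series_shift (R : realType) (x : R) n k N :
  \sum_(0 <= j < N) (if (k <= j)%N then 'C(j - k + n, n)%:R else 0) * x ^+ j =
  x ^+ k * series (fun j => 'C(j + n, n)%:R * x ^+ j) (N - k)%N.
Proof.
rewrite /series /=; elim: N => [|N IHN]; first by rewrite !big_geq ?mulr0.
rewrite big_nat_recr //= IHN; case: leqP => [lekN|ltNk].
  rewrite subSn // big_nat_recr //= mulrDr mulrCA -exprD subnKC //.
rewrite mul0r addr0; congr (_ * _).
by rewrite !big_geq // leqn0 subn_eq0 // ltnW.
Qed.

(** Pascal's rule on partial sums: the factor 1 - x lowers n by one, up to a boundary term that is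
    nonnegative for x >= 0 and tends to 0 for |x| < 1. *)
Lemma binomial_series_recl (R : realType) (x : R) n N :
  (1 - x) * series (fun j => 'C(j + n.+1, n.+1)%:R * x ^+ j) N =
  series (fun j => 'C(j + n, n)%:R * x ^+ j) N - 'C(N + n, n.+1)%:R * x ^+ N.
Proof.
rewrite /series /=; elim: N => [|N IHN].
  by rewrite !big_geq // mulr0 add0n bin_small // mul0r subr0.
rewrite !big_nat_recr //= mulrDr IHN addnS addSn binS natrD exprS; ring.
Qed.

(* By monotone convergence, this bound makes the series absolutely convergent,
   so that its terms tend to 0. *)
Lemma binomial_series_le (R : realType) (x : R) n N : 0 <= x < 1 ->
  series (fun j => 'C(j + n, n)%:R * x ^+ j) N <= (1 - x) ^- n.+1.
Proof.
move=> /andP[x0 x1].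
have x1' : 0 < 1 - x by rewrite subr_gt0.
elim: n N => [|n IHn] N.
  rewrite expr1 -[leRHS]mul1r ler_pdivlMr // mulrC.
  rewrite /series /=; under eq_bigr do rewrite addn0 bin0 mul1r.
  by rewrite -opprB mulNr big_mkord -subrX1 opprB gerBl exprn_ge0.
rewrite exprS invfM -[leRHS]mulrC ler_pdivlMr // mulrC binomial_series_recl.
apply: le_trans (IHn N).
by rewrite gerBl mulr_ge0 // exprn_ge0.
Qed.

Lemma binomial_term_cvg0 (R : realType) (x : R) n : `|x| < 1 ->
  ('C(N + n, n)%:R * x ^+ N) @[N --> \oo] --> (0 : R).
Proof.
move=> x1; apply: cvg_series_cvg_0; apply: normed_cvg.
have -> : [normed series (fun N => 'C(N + n, n)%:R * x ^+ N)] =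
    series (fun N => 'C(N + n, n)%:R * `|x| ^+ N).
  apply/funext => N; rewrite /series /=; apply: eq_bigr => j _.
  by rewrite normrM normrX normr_nat.
apply: nondecreasing_is_cvgn.
  apply: nondecreasing_series => j _ _.
  by rewrite mulr_ge0 // exprn_ge0.
exists ((1 - `|x|) ^- n.+1) => _ [N _ <-].
by apply: binomial_series_le; rewrite normr_ge0.
Qed.

Lemma binomial_series_cvg (R : realType) (x : R) n : `|x| < 1 ->
  series (fun j => 'C(j + n, n)%:R * x ^+ j) @ \oo --> (1 - x) ^- n.+1.
Proof.
move=> x1.
have x1' : 1 - x != 0.
  by rewrite subr_eq0; apply: contraTneq x1 => <-; rewrite normr1 ltxx.
elim: n => [|n IHn].
  rewrite expr1 -[X in _ --> X]mul1r.
  rewrite (_ : (fun _ => _) = geometric 1 x).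
    exact: cvg_geometric_series.
  by apply/funext => j; rewrite addn0 bin0.
(* After a shift of N by one, the boundary term is x times the general term of the series for
   n+1. *)
have h : ('C(N + n, n.+1)%:R * x ^+ N) @[N --> \oo] --> (0 : R).
  rewrite -cvg_shiftS.
  rewrite (_ : (fun _ => _) = fun N => 'C(N + n.+1, n.+1)%:R * x ^+ N * x).
    have := cvgMr_tmp (b := x) (binomial_term_cvg0 n.+1 x1).
    by rewrite mul0r; apply.
  by apply/funext => N; rewrite /= addSnnS exprSr mulrA.
rewrite (_ : series _ = fun N => (1 - x)^-1 *
    (series (fun j => 'C(j + n, n)%:R * x ^+ j) N - 'C(N + n, n.+1)%:R * x ^+ N)).
  rewrite exprS invfM -[X in _ * X]subr0.
  by apply: cvgMl_tmp; apply: cvgB.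
by apply/funext => N; rewrite -binomial_series_recl mulKf.
Qed.

(** * Formal power series: ring laws and inverses *)

(** Truncation lets commutativity and associativity be inherited from [{poly R}]. *)
Lemma fps_mul_poly (R : realType) (f g : nat -> R) N n : (n <= N)%N ->
  fps_mul f g n = (\poly_(i < N.+1) f i * \poly_(i < N.+1) g i)`_n.
Proof.
move=> lenN; rewrite coefM; apply: eq_bigr => i _.
by rewrite !coef_poly !ifT //; have := ltn_ord i; lia.
Qed.

Lemma fps_mulC (R : realType) (f g : nat -> R) : fps_mul f g = fps_mul g f.
Proof. by apply/funext => n; rewrite !(fps_mul_poly _ _ (leqnn n)) mulrC. Qed.

Lemma fps_mulA (R : realType) (f g h : nat -> R) :
  fps_mul f (fps_mul g h) = fps_mul (fps_mul f g) h.
Proof.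
apply/funext => n.
have trunc (p q : nat -> R) (i : 'I_n.+1) :
    fps_mul p q i = (\poly_(i < n.+1) p i * \poly_(i < n.+1) q i)`_i.
  by rewrite -fps_mul_poly // -ltnS.
transitivity (\poly_(i < n.+1) f i *
    (\poly_(i < n.+1) g i * \poly_(i < n.+1) h i))`_n.
  rewrite fps_mulC coefMr; apply: eq_bigr => i _.
  by rewrite trunc coef_poly ltnS leq_subr mulrC.
rewrite mulrA coefM; apply: eq_bigr => i _.
by rewrite trunc coef_poly ltnS leq_subr.
Qed.

Lemma fps_mulBr (R : realType) (f g h : nat -> R) :
  fps_mul f (g \- h) = fps_mul f g \- fps_mul f h.
Proof.
apply/funext => n; rewrite /fps_mul /= -sumrB.
by apply: eq_bigr => i _; rewrite mulrBr.
Qed.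

Lemma fps_mulr1 (R : realType) (f : nat -> R) : fps_mul f fps_one = f.
Proof.
apply/funext => n; rewrite /fps_mul /fps_one (bigD1 ord_max) //= subnn mulr1.
rewrite big1 ?addr0 // => i /eqP ne; case: eqP => [h|]; rewrite ?mulr0 //.
by case: ne; apply: val_inj => /=; have := ltn_ord i; lia.
Qed.

Lemma fps_mul_tS (R : realType) (f : nat -> R) n :
  fps_mul fps_t f n.+1 = f n.
Proof.
rewrite /fps_mul /fps_t 2!big_ord_recl /= mul0r add0r mul1r subSS subn0.
by rewrite big1 ?addr0 // => i _; rewrite mul0r.
Qed.

Lemma fps_mul_t0 (R : realType) (f : nat -> R) : fps_mul fps_t f 0 = 0.
Proof. by rewrite /fps_mul big_ord1 mul0r. Qed.

(** The first n coefficients of the inverse of g when g_0 = 1. Each is solved from all earlier ones,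
    hence the list. *)
Fixpoint fps_inv_seq (R : realType) (g : nat -> R) n : seq R :=
  if n is n'.+1 then
    let l := fps_inv_seq g n' in
    rcons l ((n' == 0)%:R - \sum_(i < n') l`_i * g (n' - i)%N)
  else [::].

Lemma fps_inv_exists (R : realType) (g : nat -> R) : g 0 = 1 ->
  exists h : nat -> R, fps_mul h g = fps_one.
Proof.
move=> g0; pose l := fps_inv_seq g.
have sl n : size (l n) = n by elim: n => //= n IHn; rewrite size_rcons IHn.
have stable n i : (i < n)%N -> (l n)`_i = (l i.+1)`_i.
  elim: n => // n IHn; rewrite ltnS leq_eqVlt => /predU1P[-> //|ltin].
  by rewrite -IHn //= nth_rcons sl ltin.
exists (fun n => (l n.+1)`_n); apply/funext => n.
rewrite /fps_mul big_ord_recr /= subnn g0 mulr1.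
rewrite nth_rcons sl ltnn eqxx.
under eq_bigr => i _ do rewrite -[nth _ _ _]/((l i.+1)`_i) -(stable n) //.
by rewrite addrC subrK.
Qed.

(** * Degenerate exponentials and Bernoulli polynomials *)

Lemma fps_div_deg_exp (R : realType) (lambda : R) :
  fps_mul (fps_div fps_t (deg_exp lambda 1 \- fps_one))
    (deg_exp lambda 1 \- fps_one) = fps_t.
Proof.
(* [fps_div] is a choice, so its equation holds once some quotient exists. *)
apply: (getPex (P := [set h | fps_mul h _ = _])).
(* e_lambda(t) - 1 = t g with g_0 = 1, so g is invertible. *)
pose g n := deg_exp lambda 1 n.+1.
have [|h hg] := @fps_inv_exists R g.
  by have := deg_expS lambda 1 0; rewrite deg_exp0 mul0r subr0 !mul1r.
exists h; rewrite /=.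
have -> : deg_exp lambda 1 \- fps_one = fps_mul fps_t g.
  apply/funext => -[|n] /=; first by rewrite fps_mul_t0 deg_exp0 subrr.
  by rewrite fps_mul_tS subr0.
by rewrite fps_mulA [fps_mul h _]fps_mulC -fps_mulA hg fps_mulr1.
Qed.

Lemma deg_expD (R : realType) (lambda x y : R) :
  fps_mul (deg_exp lambda x) (deg_exp lambda y) = deg_exp lambda (x + y).
Proof.
apply/funext; elim=> [|n IHn]; first by rewrite /fps_mul big_ord1 !deg_exp0 mulr1.
have n1 : n.+1%:R != 0 :> R by rewrite pnatr_eq0.
apply: (mulfI n1); rewrite deg_expS -IHn.
set e := deg_exp lambda.
(* The factor n+1 splits as i + (n+1-i), as in the Leibniz rule. After reindexing, the recurrences
   contribute (x - i lambda) + (y - (n-i) lambda) = x + y - n lambda. *)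
transitivity (\sum_(i < n.+2) i%:R * e x i * e y (n.+1 - i)%N +
              \sum_(i < n.+2) e x i * ((n.+1 - i)%:R * e y (n.+1 - i)%N)).
  rewrite -big_split mulr_sumr; apply: eq_bigr => i _ /=.
  by rewrite natrB ?(leq_ord i) //; ring.
rewrite big_ord_recl mul0r mul0r add0r [X in _ + X]big_ord_recr /= subnn mul0r.
rewrite mulr0 addr0 -big_split mulr_sumr; apply: eq_bigr => i _ /=.
rewrite /bump add1n subSS subSn ?(leq_ord i) // !deg_expS natrB ?(leq_ord i) //.
by rewrite -/e; ring.
Qed.

(** The difference of exponentials at x+1 and x is (e_lambda(t) - 1) e_lambda^x(t); its first factor
    cancels the denominator and leaves t e_lambda^x(t). *)
Lemma deg_BernoulliD1 (R : realType) (lambda x : R) n :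
  deg_Bernoulli lambda n.+1 (x + 1) - deg_Bernoulli lambda n.+1 x =
  n.+1%:R * deg_falling lambda x n.
Proof.
rewrite /deg_Bernoulli -mulrBr; set h := fps_div _ _.
have -> : fps_mul h (deg_exp lambda (x + 1)) n.+1 -
    fps_mul h (deg_exp lambda x) n.+1 =
    fps_mul h (deg_exp lambda (x + 1) \- deg_exp lambda x) n.+1.
  by rewrite fps_mulBr.
have -> : deg_exp lambda (x + 1) \- deg_exp lambda x =
    fps_mul (deg_exp lambda 1 \- fps_one) (deg_exp lambda x).
  by rewrite fps_mulC fps_mulBr deg_expD fps_mulr1.
rewrite fps_mulA fps_div_deg_exp fps_mul_tS /deg_exp factS natrM -mulrA.
by rewrite [_ / _]mulrC mulVKf // fact_neq0.
Qed.

Lemma sum_deg_falling (R : realType) (lambda : R) m n :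
  \sum_(k < m) deg_falling lambda k%:R n =
  n.+1%:R^-1 * (deg_Bernoulli lambda n.+1 m%:R - deg_Bernoulli lambda n.+1 0).
Proof.
elim: m => [|m IHm]; first by rewrite big_ord0 subrr mulr0.
rewrite big_ord_recr /= IHm -[m.+1%:R]natr1.
have n1 : n.+1%:R != 0 :> R by rewrite pnatr_eq0.
rewrite -[deg_falling _ _ _](mulKf n1) -deg_BernoulliD1; ring.
Qed.

Lemma poly_eq_unit_ball (R : realType) (p q : {poly R}) :
  (forall x : R, `|x| < 1 -> p.[x] = q.[x]) -> p = q.
Proof.
move=> pq; apply/eqP; rewrite -subr_eq0; apply/eqP.
(* The numbers 1/(i+2) are distinct points of the open unit ball, too many to be roots of a nonzero
   p - q. *)
pose s := [seq i.+2%:R^-1 : R | i <- iota 0 (size (p - q))].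
apply: (@roots_geq_poly_eq0 _ _ s).
- apply/allP => _ /mapP[i _ ->]; rewrite /root hornerD hornerN pq ?subrr //.
  by rewrite normfV normr_nat invf_lt1 // ltr1n.
- rewrite map_inj_uniq ?iota_uniq // => i j /invr_inj /eqP.
  by rewrite eqr_nat => /eqP[].
- by rewrite size_map size_iota.
Qed.

Lemma deg_EulerianP (R : realType) (mu : R) n (y : R) :
  deg_falling (- mu) y n =
    \sum_(k < n.+1) deg_Eulerian mu n k * deg_exp 1 (y + k%:R) n.
Proof.
have [a aE] := worpitzky mu n.
rewrite aE; apply: eq_bigr => k _; congr (_ * _).
pose A := \poly_(k < n.+1) a k.
suff EA : deg_Eulerian_poly mu n = A by rewrite /deg_Eulerian EA coef_poly ltn_ord.
(* Reflection: the expansion with coefficients a is taken at y = -(j+1). *)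
have falling_nat j : deg_falling mu j.+1%:R n =
    \sum_(i < n.+1) a i * (if (i <= j)%N then 'C(j - i + n, n)%:R else 0).
  rewrite -[mu]opprK deg_falling_opp aE mulr_sumr; apply: eq_bigr => i _.
  by rewrite mulrCA [- _ + _]addrC deg_exp1_nat_opp // -ltnS.
have Acvg (x : R) : `|x| < 1 ->
    (series (fun j : nat => deg_falling mu (j.+1)%:R n * x ^+ j) @ \oo
        --> A.[x] / (1 - x) ^+ n.+1).
  move=> x1.
  rewrite (_ : series _ = fun N => \sum_(i < n.+1) (a i * x ^+ i) *
      series (fun j => 'C(j + n, n)%:R * x ^+ j) (N - i)%N); last first.
    apply/funext => N; rewrite /series /=.
    under eq_bigr do rewrite falling_nat mulr_suml.
    rewrite exchange_big /=; apply: eq_bigr => i _.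
    under eq_bigr do rewrite -mulrA.
    by rewrite -mulr_sumr binomial_series_shift mulrA.
  rewrite horner_poly mulr_suml; apply: cvg_big => //.
    exact: add_continuous.
  move=> i _; apply: cvgMl_tmp; rewrite -(cvg_shiftn i).
  under eq_fun do rewrite addnK.
  exact: binomial_series_cvg.
(* [A] meets the defining condition, so [xget] does not fall back on 0; the chosen [B] has the same
   limits on the unit ball. *)
rewrite /deg_Eulerian_poly; case: xgetP => [B _ [_ Bcvg]|/(_ A)[]]; last first.
  by split; [exact: size_poly|exact: Acvg].
apply: poly_eq_unit_ball => x x1.
have x1' : (1 - x) ^+ n.+1 != 0.
  rewrite expf_neq0 // subr_eq0; apply: contraTneq x1 => <-.
  by rewrite normr1 ltxx.
have BA : B.[x] / (1 - x) ^+ n.+1 = A.[x] / (1 - x) ^+ n.+1.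
  by apply: cvg_unique (Bcvg x x1) (Acvg x x1); exact: norm_hausdorff.
by rewrite -[LHS](divfK x1') BA divfK.
Qed.

(** Hockey-stick identity; k <= n gives C(k, n+1) = 0, which matches the empty sum. *)
Lemma sum_bin_shift (k m n : nat) : (k <= n)%N ->
  (\sum_(i < m) 'C(i + k, n) = 'C(m + k, n.+1))%N.
Proof.
move=> lekn; elim: m => [|m IHm]; first by rewrite big_ord0 bin_small.
by rewrite big_ord_recr /= IHm addSn binS.
Qed.

Theorem theorem2p10 (R : realType) (lambda : R) (lambda_neq0 : lambda != 0)
    (m n : nat) (m_gt0 : (0 < m)%N) (n_gt0 : (0 < n)%N) :
  \sum_(j < n.+1) deg_Eulerian (- lambda) n j * 'C(m + j + 1, n + 1)%:R =
  (n.+1)%:R^-1 * (deg_Bernoulli lambda n.+1 (m.+1)%:R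
                  - deg_Bernoulli lambda n.+1 0).
Proof.
(* The right side becomes the sum of (k)_{n,lambda} over k = 0, ..., m, whose terms are then
   expanded with mu = -lambda. *)
rewrite -sum_deg_falling.
have eulerE (y : R) := deg_EulerianP (- lambda) n y.
rewrite opprK in eulerE; under [RHS]eq_bigr do rewrite eulerE.
rewrite exchange_big /=; apply: eq_bigr => j _; rewrite -mulr_sumr.
under eq_bigr do rewrite -natrD deg_exp1_nat.
by rewrite -natr_sum sum_bin_shift ?leq_ord // !addn1 addSn.
Qed.
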